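(* For every integer $n>2$ there exists a strictly positive constant $C_n$, depending only on $n$, such that for all $A\in SL(n,\mathbb{R})$ $$\int_{O_n}\log\rho(AX)\,dX\ \ge\ C_n\log\|A\|.$$ The same result holds with the unitary group in place of the orthogonal group: for every integer $n>2$ there exists a strictly positive constant $C_n'$, depending only on $n$, such that for all $A\in SL(n,\mathbb{R})$ $$\int_{U_n}\log\rho(AX)\,dX\ \ge\ C_n'\log\|A\|.$$
   Context: $O_n$ is the group of real orthogonal $n\times n$ matrices and $U_n$ the group of unitary $n\times n$ matrices; $dX$ denotes the Haar probability measure on the group in question (the integrals are averages). $\rho(M)$ is the spectral radius of $M$ (maximal absolute value of a complex eigenvalue), and $\|A\|$ is the operator norm with respect to the Euclidean norm, which equals the largest singular value of $A$. *)

(* Defs.v *)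
From HB Require Import structures.
From mathcomp Require Import all_boot all_order all_algebra.
From mathcomp Require Import all_classical all_reals all_analysis.
From mathcomp Require Import complex.

Set Implicit Arguments.
Unset Strict Implicit.
Unset Printing Implicit Defensive.

Import Order.TTheory GRing.Theory Num.Theory.
Import numFieldNormedType.Exports.

Local Open Scope classical_set_scope.
Local Open Scope ring_scope.
Local Open Scope complex_scope.

(* Stated for a numFieldType so that it serves both K = R and K = R[i] with
   the topologies induced by their absolute values. *)
Definition borel_mx (K : numFieldType) (n : nat) :=
  g_sigma_algebraType (@open 'M[K]_n).

Definition orthogonal_group (R : realType) (n : nat) : set 'M[R]_n :=
  [set X | X *m X^T = 1%:M].

Definition unitary_group (R : realType) (n : nat) : set 'M[R[i]]_n :=
  [set X | X \is unitarymx].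

(* For a compact group G of matrices: a Borel probability measure on G is
   viewed as a Borel probability measure on the matrix space carried by G. *)
Definition haar_probability (R : realType) (K : numFieldType) (n : nat)
    (G : set 'M[K]_n) (mu : probability (borel_mx K n) R) : Prop :=
  mu G = 1%E /\
  forall g : 'M[K]_n, G g ->
  forall B : set (borel_mx K n), measurable B ->
    mu ((fun X : 'M[K]_n => g *m X) @^-1` B) = mu B.

Definition spectral_radius (R : realType) (n : nat) (M : 'M[R[i]]_n) : R :=
  sup [set complex.Re `|a| | a in [set a : R[i] | eigenvalue M a]].

Definition complexify (R : realType) (n : nat) (M : 'M[R]_n) : 'M[R[i]]_n :=
  map_mx (real_complex R) M.

(* The library norm on matrices is the max norm, hence this definition. *)
Definition euclidean_norm (R : realType) (n : nat) (x : 'cV[R]_n) : R :=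
  Num.sqrt (\sum_(i < n) x i 0 ^+ 2).

Definition operator_norm (R : realType) (n : nat) (A : 'M[R]_n) : R :=
  sup [set euclidean_norm (A *m x) | x in
         [set x : 'cV[R]_n | euclidean_norm x <= 1]].

(* Main.v *)
Require Import Defs.
From HB Require Import structures.
From mathcomp Require Import all_boot all_order all_algebra.
From mathcomp Require Import perm.
From mathcomp Require Import all_classical all_reals all_analysis.
From mathcomp Require Import ring lra.
From mathcomp Require Import complex.

Set Implicit Arguments.
Unset Strict Implicit.
Unset Printing Implicit Defensive.

Import Order.TTheory GRing.Theory Num.Theory.
Import numFieldNormedType.Exports.

Local Open Scope classical_set_scope.
Local Open Scope ring_scope.
Local Open Scope complex_scope.

(** Write d for the largest singular value of A, so that the operator norm of
    A is at most d, and d >= 1 because the determinant is 1.  Since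
    |det (A X)| = 1, the spectral radius of A X is at least 1 for every X, so
    the integrand is nonnegative; it is therefore enough to find, for each A,
    a set of X of measure bounded below independently of A on which
    ln rho (A X) >= 1/2 ln d.

    Let A = K D L be a singular value decomposition (svd), D being diagonal
    with largest entry d at the index i0, and let P be the diagonal matrix
    with entry 1 at i0 and -1 elsewhere.  With g = L^T P K^T the matrix A g is
    conjugate to D P, which has d as an eigenvalue separated from all its
    other eigenvalues, the negatives of the remaining singular values, by at
    least d.  The distance is proportional to d, hence the eigenvalue survives
    when g is replaced by g Y with Y unitary and close to 1, and the closeness
    depends on n only: A g Y is conjugate to D Q with Q unitary near P, and
    det (d - D Q) is small compared with d^n, so that some eigenvalue z of D Q
    lies within d/2 of d (near_top_eigenvalue).  The eigenvector equation then
    forces the eigenvector u, a row vector, to be concentrated on the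
    coordinate i0 (near_top_eigenvector).

    This rough localisation of z says nothing when d is close to 1.  The sharp
    bound comes from unitarity of Q: |z| |u| = |u D Q| = |u D|, that is,
    |z|^2 is the mean of the squared singular values with weights
    |u_j|^2 / |u|^2.  By concavity of the logarithm 2 ln |z| is at least the
    weighted mean of the 2 ln d_j.  As the d_j have product 1, each ln d_j is
    at least - (n - 1) ln d, and since almost all of the weight sits at i0 the
    mean is at least ln d (ln_weighted_mean).  This gives
    ln rho (A g Y) >= 1/2 ln d (spectral_radius_gain).

    The measure of the set of such X = g Y is that of a fixed neighbourhood of
    1 in the group, by left invariance.  The group, being bounded, is covered
    by N translates of this neighbourhood, where N depends on n only, so that
    the measure is at least 1/N (haar_near_one_ge) and 1/(2N) is an admissible
    constant.

    Both groups are treated at once: K stands for the field of real or of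
    complex numbers, embedded in the complex numbers by phi, and the group is
    the set of matrices over K whose image under phi is unitary. *)

(** * Eigenvalues of a perturbed diagonal times reflection *)

(** The list s is that of the roots of the characteristic polynomial with
    multiplicities. *)
Lemma eigenvalues_det (C : numClosedFieldType) n (M : 'M[C]_n) :
  exists s : seq C, [/\ size s = n, {in s, forall z, eigenvalue M z} &
    forall t, \det (t%:M - M) = \prod_(z <- s) (t - z)].
Proof.
have [s] := closed_field_poly_normal (char_poly M).
rewrite (monicP (char_poly_monic M)) scale1r => sE; exists s; split.
- by have := size_char_poly M; rewrite sE size_prod_XsubC => -[].
- by move=> z zs; rewrite eigenvalue_root_char sE root_prod_XsubC.
- move=> t; transitivity (char_poly M).[t].
    rewrite /char_poly -horner_evalE -det_map_mx; congr (\det _).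
    by apply/matrixP=> i j; rewrite !mxE rmorphB rmorphMn /= !/(horner_eval _ _)
       hornerC hornerX.
  by rewrite sE horner_prod; apply: eq_bigr => z _; rewrite hornerXsubC.
Qed.

Lemma prod_const_seq (C : comPzRingType) (s : seq C) (e : C) :
  \prod_(z <- s) e = e ^+ size s.
Proof. by rewrite big_const_seq count_predT iter_mulr_1. Qed.

(** The determinant is the product of the n + 1 distances from t to the
    eigenvalues, so one of them is at most its geometric mean.  This replaces
    any continuity argument for the existence of an eigenvalue near t. *)
Lemma eigenvalue_near (C : numClosedFieldType) n (M : 'M[C]_n.+1) (t e : C) :
  0 <= e -> `|\det (t%:M - M)| <= e ^+ n.+1 ->
  exists2 z, eigenvalue M z & `|t - z| <= e.
Proof.
move=> e0; have [s [ss sM ->]] := eigenvalues_det M; rewrite normr_prod => le.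
have [|/hasPn far] := boolP (has (fun z => `|t - z| <= e) s).
  by case/hasP=> z zs tz; exists z => //; apply: sM.
suff /lt_geF : e ^+ n.+1 < \prod_(z <- s) `|t - z| by rewrite le.
rewrite -ss -prod_const_seq big_seq [ltRHS]big_seq ltr_prod //.
  by apply/hasP; exists (head 0 s); case: s ss {sM le far} => //= z s _; rewrite mem_head.
by move=> z zs; rewrite e0 real_ltNge ?far // ger0_real.
Qed.

Lemma eigenvalue_far (C : numClosedFieldType) n (M : 'M[C]_n.+1) (t e : C) :
  0 <= e -> e ^+ n.+1 <= `|\det (t%:M - M)| ->
  exists2 z, eigenvalue M z & e <= `|t - z|.
Proof.
move=> e0; have [s [ss sM ->]] := eigenvalues_det M; rewrite normr_prod => le.
have [|/hasPn far] := boolP (has (fun z => e <= `|t - z|) s).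
  by case/hasP=> z zs tz; exists z => //; apply: sM.
suff /lt_geF : \prod_(z <- s) `|t - z| < e ^+ n.+1 by rewrite le.
rewrite -ss -prod_const_seq big_seq [ltRHS]big_seq ltr_prod //.
  by apply/hasP; exists (head 0 s); case: s ss {sM le far} => //= z s _; rewrite mem_head.
by move=> z zs; rewrite normr_ge0 real_ltNge ?far // ger0_real.
Qed.

(** Every term of the Leibniz expansion contains exactly one entry of the
    distinguished row. *)
Lemma det_row_bound (C : numDomainType) n (M : 'M[C]_n.+1) i0 (a b : C) :
  (forall j, `|M i0 j| <= a) -> (forall i j, `|M i j| <= b) ->
  `|\det M| <= (n.+1)`!%:R * (a * b ^+ n).
Proof.
move=> Ma Mb; apply: le_trans (ler_norm_sum _ _ _) _.
apply: (@le_trans _ _ (\sum_(s : 'S_n.+1) a * b ^+ n)); last first.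
  by rewrite sumr_const card_Sn mulr_natl.
apply: ler_sum => s _; rewrite normrM normr_sign mul1r normr_prod (bigD1 i0) //=.
apply: ler_pM => //; first by rewrite prodr_ge0.
have <- : \prod_(i < n.+1 | i != i0) b = b ^+ n.
  by rewrite prodr_const cardC1 card_ord.
by apply: ler_prod => i _; rewrite normr_ge0 Mb.
Qed.

Lemma unitary_entry_le1 (C : numClosedFieldType) n (Q : 'M[C]_n) i j :
  Q \is unitarymx -> `|Q i j| <= 1.
Proof.
move=> /unitarymxP/matrixP/(_ i i); rewrite !mxE eqxx mulr1n => QQ.
rewrite -[_ <= _]ler_sqr ?nnegrE ?ler01 // expr1n -[leRHS]QQ (bigD1 j) //= !mxE.
by rewrite -normCK lerDl sumr_ge0 // => k _; rewrite !mxE -normCK exprn_ge0.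
Qed.

Lemma unitary_row_norm (C : numClosedFieldType) m (u : 'rV[C]_m) (Q : 'M[C]_m) :
  Q \is unitarymx ->
  \sum_j `|(u *m Q) 0 j| ^+ 2 = \sum_j `|u 0 j| ^+ 2.
Proof.
move=> /unitarymxP QQ.
have E (v : 'rV[C]_m) : \sum_j `|v 0 j| ^+ 2 = (v *m map_mx Num.conj v^T) 0 0.
  by rewrite mxE; apply: eq_bigr => j _; rewrite !mxE normCK.
by rewrite !E trmx_mul map_mxM mulmxA -(mulmxA u) QQ mulmx1.
Qed.

Definition hyperplane_reflection (C : pzRingType) n (i0 : 'I_n.+1) : 'M[C]_n.+1 :=
  diag_mx (\row_i (-1) ^+ (i != i0)).

(** The two smallness conditions on r serve different purposes: rdet makes
    det (d i0 - D Q) small enough to locate an eigenvalue, and rvec makes the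
    eigenvector small enough off the coordinate i0.  Neither depends on d. *)
Section NearReflection.
Variables (C : numClosedFieldType) (n : nat) (i0 : 'I_n.+1).

Local Notation H := (hyperplane_reflection C i0).
Variables (d : 'I_n.+1 -> C) (Q : 'M[C]_n.+1) (r : C).
Hypothesis d_gt0 : forall i, 0 < d i.
Hypothesis d_max : forall i, d i <= d i0.
Hypothesis Qr : forall i j, `|(Q - H) i j| <= r.
Hypothesis rdet : (n.+1)`!%:R * r * 2 ^+ n.*2.+1 <= 1.
Hypothesis rvec : 8 * n.+1%:R ^+ 2 * r <= 1.
Hypothesis Qunit : Q \is unitarymx.

Local Notation D := (diag_mx (\row_i d i)).

Let r_ge0 : 0 <= r.
Proof. exact: le_trans (normr_ge0 _) (Qr i0 i0). Qed.

(** For Q = H the row i0 of d i0 - D Q vanishes.  In general its entries are at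
    most d i0 * r, while all the others are at most 2 * d i0. *)
Lemma near_top_eigenvalue :
  exists2 z, eigenvalue (D *m Q) z & `|d i0 - z| <= d i0 / 2.
Proof.
have d0 := d_gt0 i0.
apply: eigenvalue_near; first by rewrite divr_ge0 ?ltW ?ltr0n.
apply: le_trans (@det_row_bound _ _ _ i0 (d i0 * r) (2 * d i0) _ _) _.
- move=> j; rewrite mul_diag_mx !mxE.
  have -> : d i0 *+ (i0 == j) - d i0 * Q i0 j =
     - (d i0 * (Q - H) i0 j).
    rewrite !mxE eqxx expr0; case: eqP => _; rewrite ?mulr1n ?mulr0n; ring.
  by rewrite normrN normrM gtr0_norm // ler_pM2l // Qr.
- move=> i j; rewrite mul_diag_mx !mxE mulr_natl mulr2n.
  apply: le_trans (ler_normB _ _) _; apply: lerD.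
    by case: eqP => _; rewrite ?normr0 ?gtr0_norm // ltW.
  rewrite normrM gtr0_norm //; apply: le_trans (d_max i).
  by rewrite ler_piMr ?unitary_entry_le1 // ltW.
- have -> : (n.+1)`!%:R * (d i0 * r * (2 * d i0) ^+ n) =
     ((n.+1)`!%:R * r * 2 ^+ n.*2.+1) * (d i0 / 2) ^+ n.+1.
    rewrite !exprMn exprVn -addnn -addSn exprD !exprS.
    have : (2 : C) ^+ n != 0 by rewrite expf_neq0 // pnatr_eq0.
    have : (2 : C) != 0 by rewrite pnatr_eq0.
    move: (2 ^+ n) => x h1 h2; field; rewrite ?h1 ?h2 //.
  by rewrite ler_piMl // exprn_ge0 // divr_ge0 ?ltW ?ltr0n.
Qed.

(** The equality between the two sums of squares is the isometry property of Q
    applied to u D; it is exact, and this is what makes the final bound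
    linear in the logarithm of d i0 even when d i0 is close to 1.  The last
    inequality holds because, off i0, the diagonal entries - d j of D H are far
    from z, so that u has nothing to be supported on. *)
Lemma near_top_eigenvector :
  exists z, eigenvalue (D *m Q) z /\ exists u : 'rV[C]_n.+1,
    [/\ 0 < \sum_j `|u 0 j| ^+ 2,
      `|z| ^+ 2 * \sum_j `|u 0 j| ^+ 2 = \sum_j d j ^+ 2 * `|u 0 j| ^+ 2 &
      2 * n.+1%:R * \sum_(j | j != i0) `|u 0 j| ^+ 2 <= \sum_j `|u 0 j| ^+ 2].
Proof.
have [z zE dz] := near_top_eigenvalue; exists z; split=> //.
have [u uz u0] := eigenvalueP zE; exists u.
have uDQ j : (\sum_k u 0 k * d k * Q k j) = z * u 0 j.
  move/rowP/(_ j): uz; rewrite mulmxA mul_mx_diag !mxE => <-.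
  by apply: eq_bigr => k _; rewrite !mxE.
split.
- rewrite lt_neqAle sumr_ge0 ?andbT => [|j _]; last by rewrite exprn_ge0.
  apply: contra u0; rewrite eq_sym psumr_eq0 => [/allP uu|j _]; last by rewrite exprn_ge0.
  apply/eqP/rowP => j; apply/eqP; move: (uu j (mem_index_enum _)).
  by rewrite mxE sqrf_eq0 normr_eq0.
- have := unitary_row_norm (u *m D) Qunit.
  rewrite -mulmxA uz mulr_sumr => E.
  under eq_bigr do rewrite -exprMn -normrM.
  transitivity (\sum_j `|(z *: u) 0 j| ^+ 2); first by apply: eq_bigr => j _; rewrite mxE.
  rewrite E; apply: eq_bigr => j _.
  by rewrite mul_mx_diag !mxE normrM exprMn mulrC (gtr0_norm (d_gt0 j)).
(* A coordinate j other than i0 satisfies (z + d j) u_j = (u D (Q - H))_j, where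
   z + d j has modulus at least d i0 / 2 as z is close to d i0. *)
pose m := \sum_k `|u 0 k|.
have uj j : j != i0 -> `|u 0 j| <= 2 * r * m.
  move=> j0; have d0 := d_gt0 i0.
  have E : (z + d j) * u 0 j = \sum_k u 0 k * d k * (Q - H) k j.
    rewrite mulrDl -uDQ; apply/eqP; rewrite eq_sym.
    under eq_bigr do rewrite mxE mulrDr.
    rewrite big_split /= (inj_eq (addrI _)) (bigD1 j) //= big1 ?addr0 => [|k kj].
      by rewrite !mxE eqxx j0 expr1 mulr1n opprK mulr1 mulrC.
    by rewrite !mxE (negPf kj) mulr0n oppr0 mulr0.
  have zd : d i0 / 2 <= `|z + d j|.
    have -> : z + d j = d i0 + d j - (d i0 - z) by ring.
    apply: le_trans (lerB_dist _ _); rewrite lerBrDr.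
    apply: le_trans (lerD (lexx _) dz) _.
    by rewrite -splitr gtr0_norm ?addr_gt0 // lerDl ltW.
  rewrite -(ler_pM2l (_ : 0 < d i0 / 2)) ?divr_gt0 ?ltr0n //.
  apply: le_trans (ler_wpM2r (normr_ge0 _) zd) _; rewrite -normrM E.
  apply: le_trans (ler_norm_sum _ _ _) _.
  rewrite [leRHS](_ : _ = \sum_k d i0 * r * `|u 0 k|); last first.
    by rewrite -mulr_sumr -/m; field.
  apply: ler_sum => k _; rewrite !normrM -mulrA mulrC -mulrA -mulrA.
  rewrite ler_pM ?mulr_ge0 // ?(gtr0_norm (d_gt0 k)) //.
  by rewrite ler_wpM2r.
pose S := \sum_j `|u 0 j| ^+ 2; rewrite -/S.
have uS j : `|u 0 j| ^+ 2 <= S.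
  by rewrite /S (bigD1 j) //= lerDl sumr_ge0 // => k _; rewrite exprn_ge0.
have S0 : 0 <= S by rewrite /S sumr_ge0 // => k _; rewrite exprn_ge0.
have mS : m ^+ 2 <= n.+1%:R ^+ 2 * S.
  rewrite -[X in _ <= _ * X]sqrtCK -exprMn.
  rewrite ler_sqr ?nnegrE ?sumr_ge0 ?mulr_ge0 ?ler0n ?sqrtC_ge0 //.
  rewrite mulr_natl -[X in _ *+ X](card_ord n.+1) -sumr_const; apply: ler_sum => k _.
  by rewrite -[leLHS]sqrCK // ler_sqrtC ?nnegrE ?exprn_ge0.
apply: (@le_trans _ _ (2 * n.+1%:R * \sum_(j : 'I_n.+1) 4 * r ^+ 2 * (n.+1%:R ^+ 2 * S))).
  rewrite ler_pM2l ?mulr_gt0 ?ltr0n // big_mkcond /=; apply: ler_sum => j _.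
  case: ifP => [/uj uj'|_]; last by rewrite !mulr_ge0 ?exprn_ge0 // ler0n.
  apply: (@le_trans _ _ ((2 * r * m) ^+ 2)).
    by rewrite ler_sqr ?nnegrE // mulr_ge0 ?sumr_ge0 // mulr_ge0 // ler0n.
  rewrite (_ : _ ^+ 2 = 4 * r ^+ 2 * m ^+ 2); last by ring.
  by rewrite ler_wpM2l ?mulr_ge0 ?exprn_ge0 ?ler0n.
rewrite sumr_const card_ord -[_ *+ _]mulr_natl.
have rv2 : (8 * n.+1%:R ^+ 2 * r) ^+ 2 <= 1.
  by rewrite expr_le1 // !mulr_ge0 ?exprn_ge0 ?ler0n.
rewrite (_ : _ * _ = (8 * n.+1%:R ^+ 2 * r) ^+ 2 * S / 8); last by field.
rewrite ler_pdivrMr ?ltr0n // mulrC ler_wpM2l //.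
by apply: le_trans rv2 _; rewrite ler1n.
Qed.
End NearReflection.

(** * Singular value decomposition over the reals *)

Lemma row_normE (R : rcfType) n (v : 'rV[R]_n) :
  v *m v^T = (\sum_j v 0 j ^+ 2)%:M.
Proof.
rewrite [LHS]mx11_scalar mxE; congr (_%:M); apply: eq_bigr => j _.
by rewrite mxE expr2.
Qed.

Lemma row_norm_gt0 (R : rcfType) n (v : 'rV[R]_n) : v != 0 ->
  0 < \sum_j v 0 j ^+ 2.
Proof.
move=> v0; rewrite lt_neqAle sumr_ge0 ?andbT => [|j _]; last by rewrite sqr_ge0.
apply: contra v0; rewrite eq_sym psumr_eq0 => [/allP vv|j _]; last by rewrite sqr_ge0.
apply/eqP/rowP => j; apply/eqP; move: (vv j (mem_index_enum _)).
by rewrite mxE sqrf_eq0.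
Qed.

(** The reflection in the hyperplane orthogonal to u - e exchanges the unit
    vectors u and e. *)
Lemma householder (R : rcfType) n (u : 'rV[R]_n.+1) : u *m u^T = 1%:M ->
  exists2 H : 'M[R]_n.+1, H *m H^T = 1%:M & delta_mx 0 0 *m H = u.
Proof.
move=> u1; pose e : 'rV[R]_n.+1 := delta_mx 0 0.
have e1 : e *m e^T = 1%:M.
  by rewrite trmx_delta mul_delta_mx; apply/matrixP => i j; rewrite !ord1 !mxE.
have [->|ue] := eqVneq u e.
  by exists 1%:M; rewrite ?trmx1 mulmx1.
pose w := u - e; pose s := (e *m u^T) 0 0; pose c := 2 - 2 * s.
have eu : e *m u^T = s%:M by rewrite [LHS]mx11_scalar.
have ue' : u *m e^T = s%:M by rewrite -[LHS]trmxK trmx_mul trmxK eu tr_scalar_mx.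
have wE : w *m w^T = c%:M.
  rewrite linearB /= mulmxBl !mulmxBr u1 e1 eu ue' -!raddfB /=.
  by congr (_%:M); rewrite /c; ring.
have ewE : e *m w^T = (- (c / 2))%:M.
  rewrite linearB /= mulmxBr e1 eu -!raddfB /=.
  by congr (_%:M); rewrite /c; field.
have c0 : c != 0.
  have := row_norm_gt0 (_ : w != 0); rewrite subr_eq0 => /(_ ue).
  apply: contraTneq => c0; move: wE; rewrite row_normE c0 => /matrixP/(_ 0 0).
  by rewrite !mxE !mulr1n => ->; rewrite ltxx.
have WW : w^T *m w *m (w^T *m w) = c *: (w^T *m w).
  by rewrite mulmxA -(mulmxA w^T) wE mul_mx_scalar -scalemxAl.
have WT : (w^T *m w)^T = w^T *m w by rewrite trmx_mul trmxK.
exists (1%:M - (2 / c) *: (w^T *m w)).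
  move: (w^T *m w) WW WT => W WW WT.
  rewrite [X in _ *m X](_ : _ = 1%:M - (2 / c) *: W); last first.
    by rewrite -{2}WT; apply/matrixP=> i j; rewrite !mxE eq_sym.
  rewrite mulmxBl !mulmxBr !mul1mx mulmx1 -scalemxAl -scalemxAr scalerA WW.
  rewrite scalerA (_ : 2 / c * _ * c = 2 / c + 2 / c) ?scalerDl; last by field.
  by rewrite opprB addrK subrK.
rewrite mulmxBr mulmx1 -scalemxAr mulmxA ewE mul_scalar_mx scalerA.
rewrite (_ : 2 / c * _ = -1) ?scaleN1r ?opprK; last by field.
by rewrite /w addrC subrK.
Qed.

(** A complex eigenvalue of a real symmetric matrix is real because the matrix is
    hermitian, and a real number that is an eigenvalue over the complex numbers
    is already one over the reals. *)
Lemma sym_eigenvector (R : rcfType) n (S : 'M[R]_n.+1) : S^T = S ->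
  exists (a : R) (u : 'rV[R]_n.+1), u *m u^T = 1%:M /\ u *m S = a *: u.
Proof.
move=> Ssym; pose Sc := map_mx (real_complex R) S.
have Sher : Sc \is hermsymmx.
  apply: realsym_hermsym.
    apply/is_hermitianmxP; rewrite expr0 scale1r.
    by apply/matrixP => i j; rewrite !mxE -{1}Ssym mxE.
  by apply/mxOverP => i j; rewrite mxE; apply/complex_realP; exists (S i j).
have /orthomx_spectralP := hermitian_normalmx Sher.
have /mxOverP/(_ 0 0)/complex_realP [a aE] := hermitian_spectral_diag_real Sher.
set P := spectralmx Sc; set sp := spectral_diag Sc in aE * => ScE.
have Pu : P \in unitmx := spectral_unit Sc.
have PS : P *m Sc = diag_mx sp *m P by rewrite ScE !mulmxA mulmxV // mul1mx.
have : eigenvalue Sc (real_complex R a).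
  apply/eigenvalueP; exists (row 0 P).
    by rewrite -row_mul PS mul_diag_mx -aE; apply/rowP => j; rewrite !mxE.
  apply: contraNneq (oner_neq0 R[i]) => P0; have := rowE 0 P.
  rewrite P0 => /(congr1 (mulmxr (invmx P))) /= /matrixP/(_ 0 0).
  by rewrite mul0mx mulmxK // !mxE !eqxx => /esym/eqP.
rewrite eigenvalue_map => /eigenvalueP [v vS v0].
pose t := \sum_j v 0 j ^+ 2; have t0 := row_norm_gt0 v0.
exists a, ((Num.sqrt t)^-1 *: v); split; last first.
  by rewrite -scalemxAl vS !scalerA mulrC.
rewrite linearZ /= -scalemxAl -scalemxAr row_normE scalerA -/t -mul_scalar_mx.
rewrite -scalar_mxM -[X in _ * X]sqr_sqrtr ?ltW //; congr (_%:M); field.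
by rewrite sqrtr_eq0 -ltNge.
Qed.

(** Conjugating by an orthogonal matrix whose first row is an eigenvector leaves a
    symmetric matrix that splits off a 1 x 1 block. *)
Lemma sym_diagonalize (R : rcfType) n (S : 'M[R]_n) : S^T = S ->
  exists (Q : 'M[R]_n) (d : 'rV[R]_n),
    Q *m Q^T = 1%:M /\ S = Q^T *m diag_mx d *m Q.
Proof.
elim: n S => [|n IH] S Ssym.
  by exists 1%:M, 0; split; apply/matrixP => -[].
have [a [u [u1 uS]]] := sym_eigenvector Ssym.
have [H HH Hu] := householder u1.
pose T : 'M[R]_(1 + n) := H *m S *m H^T.
have TD : T = H *m S *m H^T by [].
clearbody T.
have HH' : H^T *m H = 1%:M by apply: mulmx1C.
have Tsym : T^T = T by rewrite TD; rewrite !trmx_mul trmxK; rewrite Ssym; exact: mulmxA.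
have Ttop j : T 0 j = a *+ (j == 0).
  have TS : row 0 T = a *: delta_mx 0 0.
    rewrite rowE TD !mulmxA Hu uS -scalemxAl -Hu -mulmxA HH mulmx1 //.
  by move/rowP/(_ j): TS; rewrite !mxE eqxx /= => ->; rewrite mulr_natr.
have l0 : lshift n (0 : 'I_1) = 0 by apply: val_inj.
have TE : T = block_mx a%:M 0 0 (drsubmx T).
  rewrite -[LHS]submxK; congr block_mx; apply/matrixP => i j; rewrite !mxE.
  - by rewrite !ord1 l0 Ttop.
  - by rewrite !ord1 l0 Ttop.
  - by rewrite -Tsym mxE !ord1 l0 Ttop.
have [|Q [d [QQ dE]]] := IH (drsubmx T).
  by rewrite -[in RHS]Tsym trmx_drsub.
pose B : 'M[R]_(1 + n) := block_mx 1%:M 0 0 Q.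
have BT : B^T = block_mx 1%:M 0 0 Q^T by rewrite tr_block_mx !trmx0 trmx1.
have BB : B *m B^T = 1%:M.
  rewrite BT mulmx_block !mul0mx !mulmx0 !addr0 !add0r mul1mx QQ.
  by rewrite -scalar_mx_block.
have TB : T = B^T *m diag_mx (row_mx a%:M d) *m B.
  rewrite BT diag_mx_row !mulmx_block !(mul0mx, mulmx0, addr0, add0r, mul1mx, mulmx1).
  rewrite TE dE; congr block_mx.
  by apply/matrixP => i j; rewrite !mxE !ord1 !eqxx.
exists (B *m H), (row_mx a%:M d); split.
  by rewrite trmx_mul mulmxA -(mulmxA _ H) HH mulmx1 BB.
transitivity (H^T *m T *m H).
  by rewrite TD !mulmxA HH' mul1mx -mulmxA HH' mulmx1.
by rewrite TB trmx_mul !mulmxA.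
Qed.

Lemma col_normE (R : rcfType) m n (M : 'M[R]_(m, n)) i :
  (M^T *m M) i i = \sum_k M k i ^+ 2.
Proof. by rewrite mxE; apply: eq_bigr => k _; rewrite mxE expr2. Qed.

Lemma det_orthogonal (R : rcfType) n (M : 'M[R]_n) : M *m M^T = 1%:M ->
  `|\det M| = 1.
Proof.
move=> /(congr1 determinant); rewrite det_mulmx det_tr det1 -expr2 => /eqP.
by rewrite sqrf_eq1 => /orP[]/eqP->; rewrite ?normrN normr1.
Qed.

(** If A^T A = Q^T E Q with E diagonal, the columns of A Q^T are orthogonal with
    squared norms the entries of E; dividing each by its norm gives K. *)
Lemma svd (R : rcfType) n (A : 'M[R]_n) : A \in unitmx ->
  exists (K L : 'M[R]_n) (d : 'rV[R]_n),
    [/\ K *m K^T = 1%:M, L *m L^T = 1%:M, forall i, 0 < d 0 i &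
        A = K *m diag_mx d *m L].
Proof.
move=> Au; have [|Q [e [QQ AE]]] := @sym_diagonalize _ _ (A^T *m A).
  by rewrite trmx_mul trmxK.
have QQ' := mulmx1C QQ.
pose W := A *m Q^T.
have WW : W^T *m W = diag_mx e.
  rewrite trmx_mul trmxK mulmxA -(mulmxA Q) AE !mulmxA QQ mul1mx.
  by rewrite -mulmxA QQ mulmx1.
have Wu : W \in unitmx.
  by rewrite unitmx_mul Au unitmx_tr; case: (mulmx1_unit QQ).
have e0 i : 0 < e 0 i.
  have -> : e 0 i = \sum_k (row i W^T) 0 k ^+ 2.
    transitivity ((W^T *m W) i i); first by rewrite WW mxE eqxx.
    by rewrite col_normE; apply: eq_bigr => k _; rewrite !mxE.
  apply: row_norm_gt0; apply: contraNneq (oner_neq0 R) => W0.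
  have := rowE i W^T; rewrite W0 => /(congr1 (mulmxr (invmx W^T))) /=.
  rewrite mul0mx mulmxK ?unitmx_tr // => /matrixP/(_ 0 i).
  by rewrite !mxE !eqxx => /esym/eqP.
pose d : 'rV_n := \row_i Num.sqrt (e 0 i); pose d' : 'rV_n := \row_i (d 0 i)^-1.
have d0 i : 0 < d 0 i by rewrite mxE sqrtr_gt0.
have dd' : diag_mx d *m diag_mx d' = 1%:M.
  rewrite mul_diag_mx; apply/matrixP => i j.
  rewrite [LHS]mxE [diag_mx _ _ _]mxE [d' _ _]mxE [RHS]mxE mulrnAr divff //.
  by rewrite gt_eqF.
have d'd := mulmx1C dd'.
exists (W *m diag_mx d'), Q, d; split => //.
  apply: mulmx1C; rewrite trmx_mul tr_diag_mx mulmxA -(mulmxA _ W^T) WW.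
  have -> : diag_mx e = diag_mx d *m diag_mx d.
    rewrite mul_diag_mx; apply/matrixP => i j; rewrite !mxE mulrnAr -expr2 sqr_sqrtr //.
    exact: ltW.
  by rewrite mulmxA d'd mul1mx dd'.
by rewrite -!mulmxA (mulmxA (diag_mx d')) d'd mul1mx mulmxA /W -mulmxA QQ' mulmx1.
Qed.

Lemma svd_det1 (R : rcfType) n (K L : 'M[R]_n) (d : 'rV[R]_n) :
  K *m K^T = 1%:M -> L *m L^T = 1%:M -> (forall i, 0 < d 0 i) ->
  \det (K *m diag_mx d *m L) = 1 -> \prod_i d 0 i = 1.
Proof.
move=> /det_orthogonal K1 /det_orthogonal L1 d0 /(congr1 Num.norm).
rewrite !det_mulmx !normrM K1 L1 mul1r mulr1 det_diag normr1 ger0_norm //.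
by rewrite prodr_ge0 // => i _; rewrite ltW.
Qed.

(** * Spectral radius, operator norm and a weighted mean inequality *)

Lemma Re_normK (R : rcfType) (z : R[i]) : (complex.Re `|z|)%:C = `|z|.
Proof. by rewrite normc_def. Qed.

Lemma eigenvalue_le_spectral_radius (R : realType) n (M : 'M[R[i]]_n) z :
  eigenvalue M z -> complex.Re `|z| <= spectral_radius M.
Proof.
move=> zM; apply: sup_upper_bound; last by exists z.
split; first by exists (complex.Re `|z|), z.
have [s sE] := closed_field_poly_normal (char_poly M).
exists (\sum_(a <- s) complex.Re `|a|) => _ [a /= aM <-].
have as_ : a \in s.
  move: aM; rewrite eigenvalue_root_char sE (monicP (char_poly_monic M)) scale1r.
  by rewrite root_prod_XsubC.
have Re0 (w : R[i]) : 0 <= complex.Re `|w| by rewrite -ler0c Re_normK.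
by rewrite (big_rem a as_) lerDl sumr_ge0 => [|i _]; last exact: Re0.
Qed.

(** The product of the moduli of the eigenvalues is 1. *)
Lemma spectral_radius_ge1 (R : realType) n (M : 'M[R[i]]_n.+1) :
  `|\det M| = 1 -> 1 <= spectral_radius M.
Proof.
move=> M1; have [||z zM z1] := @eigenvalue_far _ _ M 0 1 _ _ => //.
  rewrite expr1n (_ : 0%:M - M = -1 *: M); last by rewrite scaleN1r raddf0 sub0r.
  by rewrite detZ normrM normrX M1 normrN1 expr1n mulr1.
apply: le_trans (eigenvalue_le_spectral_radius zM).
by rewrite -lecR Re_normK; move: z1; rewrite sub0r normrN.
Qed.

Lemma operator_norm_le (R : realType) n (K L : 'M[R]_n) (d : 'rV[R]_n) (m : R) :
  K *m K^T = 1%:M -> L *m L^T = 1%:M -> (forall i, 0 < d 0 i <= m) -> 0 <= m ->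
  operator_norm (K *m diag_mx d *m L) <= m.
Proof.
move=> /mulmx1C KK /mulmx1C LL dm m0; apply: ge_sup.
  exists 0, 0 => /=; rewrite /euclidean_norm.
    by rewrite big1 ?sqrtr0 // => i _; rewrite mxE expr0n.
  by rewrite big1 ?sqrtr0 // => i _; rewrite mulmx0 mxE expr0n.
have normE (M : 'M[R]_n) (x : 'cV[R]_n) : M^T *m M = 1%:M ->
    euclidean_norm (M *m x) = euclidean_norm x.
  move=> MM; rewrite /euclidean_norm; congr Num.sqrt.
  by rewrite -!col_normE trmx_mul mulmxA -(mulmxA _ M^T) MM mulmx1.
move=> _ [x /= x1 <-]; rewrite -!mulmxA normE //.
rewrite -(normE L) // in x1; move: (L *m x) x1 => y y1.
apply: (@le_trans _ _ (m * euclidean_norm y)); last by rewrite ler_piMr.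
rewrite /euclidean_norm -{1}(ger0_norm m0) -sqrtr_sqr -sqrtrM ?sqr_ge0 //.
rewrite ler_wsqrtr // mulr_sumr ler_sum // => i _; have /andP[di0 dim] := dm i.
by rewrite mul_diag_mx mxE -exprMn !exprMn ler_wpM2r ?sqr_ge0 // ler_sqr ?nnegrE // ltW.
Qed.

Lemma ln_prod (R : realType) (I : Type) (s : seq I) (d : I -> R) :
  (forall i, 0 < d i) -> ln (\prod_(i <- s) d i) = \sum_(i <- s) ln (d i).
Proof.
move=> d0; elim: s => [|i s IH]; first by rewrite !big_nil ln1.
by rewrite !big_cons lnM ?posrE ?prodr_gt0 // IH.
Qed.

Lemma ln_max_ge0 (R : realType) n (i0 : 'I_n.+1) (d : 'I_n.+1 -> R) :
  (forall i, 0 < d i <= d i0) -> \prod_i d i = 1 -> 0 <= ln (d i0).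
Proof.
move=> dd d1; have d0 i : 0 < d i by case/andP: (dd i).
rewrite -(pmulrn_lge0 _ (ltn0Sn n)) -(ln1 R) -d1 ln_prod //.
rewrite -[X in _ *+ X](card_ord n.+1) -sumr_const ler_sum // => i _.
by rewrite ler_ln ?posrE //; case/andP: (dd i).
Qed.

(** Here t is the weighted mean of the d i ^ 2 with weights q i.  Jensen gives
    ln t >= 2 * mean of ln (d i); every ln (d i) is at least - n ln (d i0), and
    the weight of the indices other than i0 is at most 1 / (2 (n + 1)). *)
Lemma ln_weighted_mean (R : realType) n (i0 : 'I_n.+1) (d q : 'I_n.+1 -> R) (t : R) :
  (forall i, 0 < d i <= d i0) -> \prod_i d i = 1 ->
  (forall i, 0 <= q i) -> 0 < \sum_i q i -> 0 < t ->
  t * \sum_i q i = \sum_i d i ^+ 2 * q i ->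
  2 * n.+1%:R * \sum_(i | i != i0) q i <= \sum_i q i ->
  ln (d i0) <= ln t.
Proof.
move=> dd d1 q0 S0 t0 tE small.
have d0 i : 0 < d i by case/andP: (dd i).
have lnd i : ln (d i) <= ln (d i0) by rewrite ler_ln ?posrE //; case/andP: (dd i).
have lnsum : \sum_i ln (d i) = 0 by rewrite -ln_prod // d1 ln1.
set l := ln (d i0) in lnd *.
have l0 : 0 <= l := ln_max_ge0 dd d1.
have lnd_ge j : - (n%:R * l) <= ln (d j).
  have -> : ln (d j) = - \sum_(k | k != j) ln (d k).
    by move: lnsum; rewrite (bigD1 j) //= => /eqP; rewrite addr_eq0 => /eqP.
  rewrite lerN2 mulr_natl -[X in _ *+ X](_ : #|predC1 j| = n); last first.
    by rewrite cardC1 card_ord.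
  by rewrite -sumr_const ler_sum.
(* Jensen for the logarithm, from its tangent ln x <= x - 1 at x = d i ^ 2 / t. *)
have jensen : 2 * \sum_i q i * ln (d i) <= ln t * \sum_i q i.
  rewrite -subr_le0.
  apply: (@le_trans _ _ (\sum_i (q i * (d i ^+ 2 / t - 1)))); last first.
    under eq_bigr do rewrite mulrBr mulr1 mulrA (mulrC (q _)).
    by rewrite sumrB -mulr_suml -tE mulrAC divff ?gt_eqF // mul1r subrr.
  rewrite mulr_sumr mulr_sumr -sumrB ler_sum // => i _.
  have dt : 0 < d i ^+ 2 / t by rewrite divr_gt0 ?exprn_gt0.
  have := @le_ln1Dx _ (d i ^+ 2 / t - 1).
  rewrite ltrBDr addNr addrC subrK => /(_ dt).
  rewrite ln_div ?posrE ?exprn_gt0 // lnXn // => h.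
  apply: le_trans (ler_wpM2l (q0 i) h).
  by rewrite -mulr_natl le_eqVlt; apply/orP; left; apply/eqP; ring.
have low : l * (\sum_i q i) <= 2 * \sum_i q i * ln (d i).
  apply: (@le_trans _ _ (2 * (q i0 * l - n%:R * l * \sum_(i | i != i0) q i))).
    move: (ler_wpM2l l0 small); rewrite [\sum_i q i](bigD1 i0) //=.
    rewrite -natr1; move: (\sum_(i | _) q i) => a; nra.
  rewrite ler_pM2l // [leRHS](bigD1 i0) //= lerD2l mulr_sumr -sumrN ler_sum // => i _.
  by rewrite -mulNr [leRHS]mulrC ler_wpM2r.
by rewrite -(ler_pM2r S0) (le_trans low).
Qed.

(** * Uniform spectral gain near a well chosen orthogonal matrix *)

Lemma eigenvalue_conj (F : fieldType) n (K K' M : 'M[F]_n) z :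
  K *m K' = 1%:M -> eigenvalue M z -> eigenvalue (K *m M *m K') z.
Proof.
move=> KK /eigenvalueP [v vM v0]; apply/eigenvalueP; exists (v *m K').
  by rewrite !mulmxA -(mulmxA v) (mulmx1C KK) mulmx1 vM scalemxAl.
apply: contraNneq v0 => /(congr1 (mulmxr K)) /=.
by rewrite -mulmxA (mulmx1C KK) mulmx1 mul0mx => ->.
Qed.

Lemma complexify_unitary (R : realType) n (M : 'M[R]_n) :
  (complexify M \is unitarymx) = (M *m M^T == 1%:M).
Proof.
have conjE : map_mx Num.conj (complexify M)^T = complexify M^T.
  apply/matrixP => i j; rewrite !mxE; apply: CrealP.
  by apply/complex_realP; exists (M j i).
apply/unitarymxP/eqP => [|MM]; rewrite conjE -map_mxM ?MM ?map_mx1 //.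
by rewrite -(map_mx1 (real_complex R)) => /map_mx_inj.
Qed.

Lemma mulmx_entry_le (C : numDomainType) m n p (A : 'M[C]_(m, n)) (B : 'M[C]_(n, p)) a b :
  (forall i j, `|A i j| <= a) -> (forall i j, `|B i j| <= b) ->
  forall i j, `|(A *m B) i j| <= n%:R * (a * b).
Proof.
move=> Aa Bb i j; rewrite mxE; apply: le_trans (ler_norm_sum _ _ _) _.
rewrite mulr_natl -[X in _ *+ X](card_ord n) -sumr_const ler_sum // => k _.
by rewrite normrM ler_pM.
Qed.

(** Chosen so that r = (n + 1) ^ 2 * tolerance fulfils both smallness conditions
    of near_top_eigenvector; the factor (n + 1) ^ 2 is the loss when Y - 1 is
    conjugated by a unitary matrix and sizes are measured entrywise. *)
Definition tolerance (R : realType) n : R :=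
  (8 * n.+1%:R ^+ 4 * (n.+1)`!%:R * 2 ^+ n.*2.+1)^-1.

Lemma tolerance_gt0 (R : realType) n : 0 < tolerance R n.
Proof. by rewrite invr_gt0 !mulr_gt0 ?exprn_gt0 ?ltr0n ?fact_gt0. Qed.

(** With A = K D L, the choice g = L^T P K^T turns A g Y into the conjugate by K of
    D Q, where Q = P (K^T Y K) is as close to the reflection P as Y is to 1, up
    to a factor depending on n only. *)
Lemma spectral_radius_gain (R : realType) n (A : 'M[R]_n.+1) : \det A = 1 ->
  exists2 g : 'M[R]_n.+1, g *m g^T = 1%:M &
    forall Y : 'M[R[i]]_n.+1, Y \is unitarymx ->
      (forall i j, `|(Y - 1%:M) i j| <= (tolerance R n)%:C) ->
      2^-1 * ln (operator_norm A) <=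
        ln (spectral_radius (complexify A *m (complexify g *m Y))).
Proof.
move=> A1; have [|K [L [d [KK LL d0 AE]]]] := @svd _ _ A.
  by rewrite unitmxE A1 unitr1.
have d1 : \prod_i d 0 i = 1 by apply: svd_det1 KK LL d0 _; rewrite -AE.
pose i0 := [arg max_(i > ord0) d 0 i]%O.
have dmax i : d 0 i <= d 0 i0 by rewrite /i0; case: arg_maxP => // j _ h; apply: h.
have opA : operator_norm A <= d 0 i0.
  by rewrite AE; apply: operator_norm_le => // [i|]; rewrite ?d0 ?dmax ?ltW.
pose P : 'M[R]_n.+1 := hyperplane_reflection _ i0.
have PT : P^T = P by rewrite tr_diag_mx.
have PP : P *m P^T = 1%:M.
  rewrite PT mul_diag_mx; apply/matrixP => i j; rewrite !mxE mulrnAr -expr2.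
  by rewrite -exprM mulnC exprM sqrrN expr1n expr1n.
have KK' := mulmx1C KK; have LL' := mulmx1C LL.
exists (L^T *m P *m K^T).
  rewrite !trmx_mul !trmxK !mulmxA -(mulmxA _ K^T) KK' mulmx1.
  by rewrite -(mulmxA _ P) PP mulmx1.
move=> Y Yu Yr; set M := _ *m _.
have cP : complexify P = hyperplane_reflection _ i0.
  rewrite /complexify map_diag_mx; congr diag_mx; apply/rowP => j.
  by rewrite !mxE rmorphXn rmorphN1.
pose Q := complexify P *m (complexify K^T *m Y *m complexify K).
have cM (U V : 'M[R]_n.+1) : complexify (U *m V) = complexify U *m complexify V.
  exact: map_mxM.
have cLL : complexify L *m complexify L^T = 1%:M by rewrite -cM LL /complexify map_mx1.
have cKK : complexify K *m complexify K^T = 1%:M by rewrite -cM KK /complexify map_mx1.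
have ME : M = complexify K *m (complexify (diag_mx d) *m Q) *m complexify K^T.
  rewrite /M /Q AE !cM -!mulmxA cKK mulmx1 (mulmxA (complexify L)) cLL mul1mx.
  by [].
have Ku : complexify K \is unitarymx by rewrite complexify_unitary KK.
have Ktu : complexify K^T \is unitarymx by rewrite complexify_unitary trmxK KK'.
have Pu : complexify P \is unitarymx by rewrite complexify_unitary PP.
have Qu : Q \is unitarymx.
  exact: mul_unitarymx Pu (mul_unitarymx (mul_unitarymx Ktu Yu) Ku).
pose r : R[i] := n.+1%:R ^+ 2 * (tolerance R n)%:C.
have QP i j : `|(Q - hyperplane_reflection _ i0) i j| <= r.
  have -> : Q - hyperplane_reflection _ i0 =
      complexify P *m (complexify K^T *m (Y - 1%:M) *m complexify K).
    rewrite mulmxBr mulmx1 mulmxBl mulmxBr -/Q -cP.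
    by rewrite -map_mxM KK' map_mx1 mulmx1.
  have PE (X : 'M[R[i]]_n.+1) : `|(complexify P *m X) i j| = `|X i j|.
    rewrite cP mul_diag_mx !mxE normrM.
    by case: eqP => _; rewrite ?expr0 ?expr1 ?normrN normr1 mul1r.
  rewrite PE.
  have h1 := mulmx_entry_le (fun i j => unitary_entry_le1 i j Ktu) Yr.
  have := mulmx_entry_le h1 (fun i j => unitary_entry_le1 i j Ku) i j.
  by rewrite mul1r mulr1 mulrA -expr2.
have tol0 := tolerance_gt0 R n.
pose N : R := n.+1%:R; pose f : R := (n.+1)`!%:R; pose b : R := 2 ^+ n.*2.+1.
have N1 : 1 <= N by rewrite ler1n.
have f1 : 1 <= f by rewrite ler1n fact_gt0.
have b1 : 1 <= b by rewrite exprn_ege1 // ler1n.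
have tE : tolerance R n = (8 * N ^+ 4 * f * b)^-1 by [].
have N0 : N != 0 by rewrite gt_eqF // (lt_le_trans ltr01).
have f0 : f != 0 by rewrite gt_eqF // (lt_le_trans ltr01).
have b0 : b != 0 by rewrite gt_eqF // (lt_le_trans ltr01).
have rE : r = (N ^+ 2 * tolerance R n)%:C by rewrite rmorphM rmorphXn rmorph_nat.
have rdet : (n.+1)`!%:R * r * 2 ^+ n.*2.+1 <= 1.
  have -> : (n.+1)`!%:R * r * 2 ^+ n.*2.+1 = (8 * N ^+ 2)^-1%:C.
    transitivity (f * (N ^+ 2 * tolerance R n) * b)%:C.
      by rewrite rE !rmorphM rmorphXn !rmorph_nat.
    by congr (_%:C); rewrite tE; field; rewrite ?N0 ?f0 ?b0 ?andbT /=.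
  rewrite -(rmorph1 (real_complex R)) lecR invf_le1 ?mulr_gt0 ?exprn_gt0 ?ltr0n //.
  have : 1 <= N ^+ 2 by rewrite exprn_ege1.
  lra.
have rvec : 8 * n.+1%:R ^+ 2 * r <= 1.
  have -> : 8 * n.+1%:R ^+ 2 * r = (f * b)^-1%:C.
    transitivity (8 * N ^+ 2 * (N ^+ 2 * tolerance R n))%:C.
      by rewrite rE !rmorphM !rmorph_nat !expr2.
    by congr (_%:C); rewrite tE; field; rewrite ?N0 ?f0 ?b0 ?andbT /=.
  rewrite -(rmorph1 (real_complex R)) lecR invf_le1 ?mulr_gt0 ?(lt_le_trans ltr01) //.
  by rewrite mulr_ege1.
have [||z [zE [u [u0 uE us]]]] := @near_top_eigenvector R[i] n i0
    (fun i => (d 0 i)%:C) Q r _ _ QP rdet rvec Qu.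
- by move=> i; rewrite ltcR.
- by move=> i; rewrite lecR.
pose q j := complex.Re `|u 0 j| ^+ 2.
have qE j : `|u 0 j| ^+ 2 = (q j)%:C by rewrite rmorphXn /= -Re_normK.
have qS (p : pred 'I_n.+1) :
    \sum_(j | p j) `|u 0 j| ^+ 2 = (\sum_(j | p j) q j)%:C.
  by rewrite raddf_sum; apply: eq_bigr => j _; apply: qE.
have qdS : \sum_j (d 0 j)%:C ^+ 2 * `|u 0 j| ^+ 2 = (\sum_j d 0 j ^+ 2 * q j)%:C.
  rewrite raddf_sum; apply: eq_bigr => j _.
  by rewrite qE -rmorphXn -rmorphM.
move: u0 uE us; rewrite qdS !qS -Re_normK -rmorphXn ltcR => S0.
rewrite -rmorphM => /complexI uE.
rewrite (_ : 2 * n.+1%:R = (2 * n.+1%:R)%:C); last by rewrite rmorphM !rmorph_nat.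
rewrite -rmorphM lecR => us.
have z0 : 0 < complex.Re `|z| ^+ 2.
  rewrite -(pmulr_lgt0 _ S0) uE lt_neqAle sumr_ge0 ?andbT => [|j _]; last first.
    by rewrite mulr_ge0 ?sqr_ge0.
  apply: contraTneq S0 => /esym/eqP; rewrite psumr_eq0 => [/allP qq|j _]; last first.
    by rewrite mulr_ge0 ?sqr_ge0.
  rewrite big1 ?ltxx // => j _; move: (qq j (mem_index_enum _)).
  by rewrite mulf_eq0 sqrf_eq0 gt_eqF //= => /eqP.
have dd i : 0 < d 0 i <= d 0 i0 by rewrite d0 dmax.
have lt : ln (d 0 i0) <= ln (complex.Re `|z| ^+ 2).
  by apply: ln_weighted_mean S0 z0 uE us => // i; rewrite /q sqr_ge0.
have DE : diag_mx (\row_i (d 0 i)%:C) = complexify (diag_mx d).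
  by rewrite /complexify map_diag_mx; congr diag_mx; apply/rowP => j; rewrite !mxE.
have zM : eigenvalue M z.
  by rewrite DE in zE; rewrite ME; exact: eigenvalue_conj cKK zE.
have {}zM := eigenvalue_le_spectral_radius zM.
have z_gt0 : 0 < complex.Re `|z|.
  have : 0 <= complex.Re `|z| by rewrite -ler0c Re_normK.
  by rewrite le_eqVlt => /predU1P[zz|//]; rewrite -zz expr0n ltxx in z0.
have lnop : ln (operator_norm A) <= ln (d 0 i0).
  have [op0|op0] := leP (operator_norm A) 0.
    by rewrite ln0 // (ln_max_ge0 dd d1).
  by rewrite ler_ln ?posrE.
have lnz : ln (complex.Re `|z|) <= ln (spectral_radius M).
  by rewrite ler_ln ?posrE // (lt_le_trans z_gt0).
by move: lt; rewrite lnXn // mulr2n; lra.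
Qed.

(** * A finite net in a set of unitary matrices *)

(** The shift by 1 makes the argument nonnegative for x between -1 and 1, where
    truncation is the floor; points with the same index are then within 1/m. *)
Definition grid_index (R : realType) (m : nat) (x : R) : 'I_(m.*2).+1 :=
  inord (Num.truncn (m%:R * (x + 1))).

Lemma grid_index_close (R : realType) (m : nat) (x y : R) : (0 < m)%N ->
  `|x| <= 1 -> `|y| <= 1 -> grid_index m x = grid_index m y ->
  `|x - y| <= m%:R^-1.
Proof.
move=> m0 x1 y1 /(congr1 val) /=.
have m0' : 0 < m%:R :> R by rewrite ltr0n.
have bnd (z : R) : `|z| <= 1 -> 0 <= m%:R * (z + 1) /\
    (Num.truncn (m%:R * (z + 1)) < (m.*2).+1)%N.
  rewrite ler_norml => /andP[z1 z2]; have h : 0 <= m%:R * (z + 1).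
    by rewrite mulr_ge0 // -[1]opprK subr_ge0.
  split=> //; rewrite truncn_lt_nat // -natr1 -muln2 natrM ltr_pwDr // ler_pM2l //.
  by rewrite -[X in _ <= X]/(1 + 1) lerD2r.
have [xm xn] := bnd x x1; have [ym yn] := bnd y y1.
rewrite !inordK // => E.
have /andP[xl xu] := truncn_itv xm; have /andP[yl yu] := truncn_itv ym.
rewrite E in xl xu; rewrite -natr1 in xu yu.
have mm : m%:R * m%:R^-1 = 1 :> R by rewrite divff ?gt_eqF.
rewrite ler_norml; apply/andP; split; rewrite -(ler_pM2l m0') ?mulrN mm; lra.
Qed.

Lemma norm_Re_le (R : rcfType) (z : R[i]) (a : R) : `|z| <= a%:C ->
  `|complex.Re z| <= a /\ `|complex.Im z| <= a.
Proof.
case: z => x y; rewrite normc_def lecR /= => h; split; apply: le_trans h.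
  by rewrite -sqrtr_sqr ler_wsqrtr // lerDl sqr_ge0.
by rewrite -sqrtr_sqr ler_wsqrtr // lerDr sqr_ge0.
Qed.

Lemma norm_le_ReIm (R : rcfType) (z : R[i]) :
  `|z| <= (`|complex.Re z| + `|complex.Im z|)%:C.
Proof.
case: z => x y; rewrite normc_def lecR /=.
rewrite -[leRHS]ger0_norm ?addr_ge0 // -[leRHS]sqrtr_sqr ler_wsqrtr // sqrrD.
by rewrite !real_normK ?num_real // lerD2r lerDl mulrn_wge0 // mulr_ge0.
Qed.

(** The entries of unitary matrices lie in the unit disc, which a grid cuts into
    finitely many small cells; one element of G is kept for each nonempty
    cell of the product.  The net depends on G only, hence so does its size. *)
Lemma unitary_net (R : realType) n (T : choiceType) (G : set T)
    (F : T -> 'M[R[i]]_n) (x0 : T) (e : R) : G x0 -> 0 < e ->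
  (forall x, G x -> F x \is unitarymx) ->
  exists s : seq T, (forall x, x \in s -> G x) /\
    forall x, G x -> exists2 y, y \in s & forall i j, `|(F x - F y) i j| <= e%:C.
Proof.
move=> Gx0 e0 Fu; pose m := (Num.truncn (2 / e)).+1.
have me : 2 * m%:R^-1 <= e.
  rewrite ler_pdivrMr ?ltr0n // mulrC -ler_pdivrMr //.
  have /truncn_itv/andP[_] : 0 <= 2 / e by rewrite divr_ge0 ?ltW.
  by move/ltW.
pose cell x := [ffun ij : 'I_n * 'I_n =>
  (grid_index m (complex.Re (F x ij.1 ij.2)), grid_index m (complex.Im (F x ij.1 ij.2)))].
pose rep k := xget x0 [set x | G x /\ cell x = k].
(* An empty cell is represented by x0, which belongs to G as well. *)
exists [seq rep k |
  k <- enum {: {ffun 'I_n * 'I_n -> 'I_(m.*2).+1 * 'I_(m.*2).+1}}]; split.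
  move=> x /mapP [k _ ->]; rewrite /rep; case: xgetP => [y _ []|] //.
move=> x Gx; have [Gy yx] : G (rep (cell x)) /\ cell (rep (cell x)) = cell x.
  by rewrite /rep; case: xgetP => [y _ []|/(_ x)[]].
exists (rep (cell x)); first by rewrite map_f // mem_enum.
move: (rep _) Gy yx => y Gy yx i j; move/ffunP/(_ (i, j)): yx.
rewrite !ffunE /= => -[er ei].
have [xr xi] := norm_Re_le (unitary_entry_le1 i j (Fu _ Gx)).
have [yr yi] := norm_Re_le (unitary_entry_le1 i j (Fu _ Gy)).
apply: le_trans (norm_le_ReIm _) _; rewrite lecR; apply: le_trans me.
rewrite mulr_natl mulr2n !mxE !raddfB /=.
by rewrite lerD // grid_index_close.
Qed.

(** * Continuity of matrix operations *)

Lemma continuous_sum (K : numFieldType) (T : topologicalType) (I : finType)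
    (f : I -> T -> K) :
  (forall i, continuous (f i)) -> continuous (fun x => \sum_i f i x).
Proof.
move=> fc x; rewrite /continuous_at; elim: (index_enum I) => [|i r IH].
  by rewrite big_nil; under eq_fun do rewrite big_nil; exact: cvg_cst.
rewrite big_cons; under eq_fun do rewrite big_cons.
by apply: cvgD => //; exact: fc.
Qed.

Lemma mulmx_continuous (K : numFieldType) n (h : 'M[K]_n) :
  continuous (fun X : 'M[K]_n => h *m X).
Proof.
move=> X A [P PX PA].
have entry ij : \forall N \near X, P ij.1 ij.2 ((h *m N) ij.1 ij.2).
  have : continuous (fun N : 'M[K]_n => (h *m N) ij.1 ij.2).
    have -> : (fun N : 'M[K]_n => (h *m N) ij.1 ij.2) =
        (fun N => \sum_k h ij.1 k * N k ij.2).
      by apply/funext => N; rewrite mxE.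
    apply: continuous_sum => k N.
    exact: (cvgM (cvg_cst (h ij.1 k)) (@coord_continuous K n n k ij.2 N)).
  by move=> c; exact: (c X _ (PX ij.1 ij.2)).
apply: filterS (filter_forall _ entry) => N NP; apply: PA => i j.
exact: (NP (i, j)).
Qed.

Lemma uniformly_continuous (K L : numFieldType) (f : K -> L) :
  (forall e, 0 < e -> exists2 d, 0 < d & forall x y, `|x - y| < d -> `|f x - f y| < e) ->
  continuous f.
Proof.
move=> fu x A /(@nbhs_ballP _ L) [e /= e0 eA]; have [d d0 fd] := fu e e0.
by apply/(@nbhs_ballP _ K); exists d => // y xy; apply: eA; exact: fd.
Qed.

Lemma conj_continuous (R : realType) :
  continuous (Num.conj : (R[i] : numFieldType) -> (R[i] : numFieldType)).
Proof.
apply: uniformly_continuous => e e0; exists e => // x y xy.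
by rewrite -rmorphB norm_conjC.
Qed.

Section IntermediateField.
Variables (R : realType) (K : numFieldType) (n : nat).
Variables (phi : {rmorphism K -> R[i]}) (psi : {rmorphism R -> K}).
Hypothesis phi_psi : forall x, phi (psi x) = x%:C.
Hypothesis phi_norm : forall x, phi `|x| = `|phi x|.
Hypothesis phi_lt : {mono phi : x y / x < y}.

Lemma phi_continuous : continuous (phi : K -> (R[i] : numFieldType)).
Proof.
apply: uniformly_continuous => e e0.
have /complex_realP[a ea] := gtr0_real e0.
exists (psi a); first by rewrite -phi_lt phi_psi -ea rmorph0.
by move=> x y xy; rewrite -rmorphB -phi_norm ea -phi_psi phi_lt.
Qed.

(** The orthogonal group for K real, the unitary group for K complex. *)
Definition unitary_points : set 'M[K]_n := [set X | map_mx phi X \is unitarymx].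

Lemma unitary_points_closed : closed unitary_points.
Proof.
have -> : unitary_points = \bigcap_(ij in [set: 'I_n * 'I_n])
   ((fun X : 'M[K]_n => \sum_k phi (X ij.1 k) * Num.conj (phi (X ij.2 k)))
    : _ -> (R[i] : numFieldType))
     @^-1` [set (ij.1 == ij.2)%:R].
  apply/seteqP; split => X.
    move=> /unitarymxP/matrixP XX [i j] _ /=; move: (XX i j); rewrite !mxE => <-.
    by apply: eq_bigr => k _; rewrite !mxE.
  move=> XX; apply/unitarymxP/matrixP => i j; rewrite !mxE.
  rewrite -[RHS](XX (i, j)) //; apply: eq_bigr => k _; by rewrite !mxE.
apply: closed_bigI => ij _; apply: preimage_closed.
  have phiX (i k : 'I_n) :
      continuous (fun X : 'M[K]_n => phi (X i k) : (R[i] : numFieldType)).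
    move=> X A nA; have nA' := @phi_continuous (X i k) _ nA.
    exact: (@coord_continuous K n n i k X _ nA').
  move=> X _; move: X; apply: continuous_sum => k X.
  apply: (cvgM (phiX _ _ X)) => A nA.
  by have /(phiX _ _ X) := @conj_continuous R (phi (X ij.2 k)) _ nA.
apply: accessible_closed_set1; apply: hausdorff_accessible; exact: norm_hausdorff.
Qed.
End IntermediateField.

(** * Haar measure of a neighbourhood of the identity *)

Lemma borel_open (K : numFieldType) n (A : set (borel_mx K n)) :
  @open 'M[K]_n A -> measurable A.
Proof. exact: sub_sigma_algebra. Qed.

Lemma borel_closed (K : numFieldType) n (A : set (borel_mx K n)) :
  @closed 'M[K]_n A -> measurable A.
Proof.
move=> /closed_openC /borel_open /measurableC; by rewrite setCK.
Qed.

(** The integral of a nonnegative function is a supremum over the simple functions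
    below it, and c times the indicator of B is one of them.  This spares a
    proof that the spectral radius is measurable. *)
Lemma integral_ge_of_ge d (T : measurableType d) (R : realType)
    (mu : {measure set T -> \bar R}) (D B : set T) (f : T -> R) (c : R) :
  measurable B -> B `<=` D -> 0 <= c ->
  (forall x, D x -> 0 <= f x) -> (forall x, B x -> c <= f x) ->
  (c%:E * mu B <= \int[mu]_(x in D) (f x)%:E)%E.
Proof.
move=> mB BD c0 f0 fc; rewrite ge0_integralE => [|x Dx]; last by rewrite lee_fin f0.
apply: ereal_sup_ubound => /=.
exists (scale_nnsfun (indic_nnsfun R mB) c0).
  move=> x; rewrite [X in (X <= _)%E](_ : _ = (c * \1_B x)%:E) // indicE patchE.
  case: ifPn => [|/negP]; rewrite inE => Dx.
    have [|_] := boolP (x \in B); last by rewrite mulr0 lee_fin f0.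
    by rewrite inE => Bx; rewrite mulr1 lee_fin fc.
  by rewrite memNset ?mulr0 // => /BD.
by rewrite sintegralrM sintegral_indic.
Qed.

Lemma det_unitary (C : numClosedFieldType) n (U : 'M[C]_n) :
  U \is unitarymx -> `|\det U| = 1.
Proof.
move=> /unitarymxP /(congr1 determinant).
rewrite det_mulmx det_map_mx det_tr det1 -normCK => /eqP.
by rewrite pexpr_eq1 // => /eqP.
Qed.

Section IntermediateField.
Variables (R : realType) (K : numFieldType) (n : nat).
Variables (phi : {rmorphism K -> R[i]}) (psi : {rmorphism R -> K}).
Hypothesis phi_psi : forall x, phi (psi x) = x%:C.
Hypothesis phi_norm : forall x, phi `|x| = `|phi x|.
Hypothesis phi_lt : {mono phi : x y / x < y}.

Local Notation G := (unitary_points phi : set 'M[K]_n.+1).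

Definition near_one : set (borel_mx K n.+1) :=
  G `&` ball (1%:M : 'M[K]_n.+1) (psi (tolerance R n)).

Definition translate (g : 'M[K]_n.+1) : set (borel_mx K n.+1) :=
  (fun X : 'M[K]_n.+1 => invmx g *m X) @^-1` near_one.

Lemma measurable_unitary_points : measurable (G : set (borel_mx K n.+1)).
Proof.
by apply: borel_closed; exact: (unitary_points_closed phi_psi phi_norm phi_lt).
Qed.

Lemma measurable_near_one : measurable near_one.
Proof.
apply: measurableI; first exact: measurable_unitary_points.
by apply: borel_open; exact: (@ball_open K 'M[K]_n.+1).
Qed.

Lemma measurable_translate g : measurable (translate g).
Proof.
rewrite /translate /near_one preimage_setI; apply: measurableI.
  apply: borel_closed; apply: preimage_closed.
    by move=> X _; exact: mulmx_continuous.
  exact: (unitary_points_closed phi_psi phi_norm phi_lt).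
apply: borel_open; have /continuousP := @mulmx_continuous K n.+1 (invmx g).
by apply; exact: ball_open.
Qed.

Lemma unitary_points1 : G 1%:M.
Proof.
rewrite /unitary_points /= map_mx1; apply/unitarymxP.
by rewrite trmx1 map_mx1 mulmx1.
Qed.

Lemma unitary_points_unit g : G g -> g \in unitmx.
Proof. by move=> /unitarymx_unit; rewrite map_unitmx. Qed.

Lemma unitary_pointsV g : G g -> G (invmx g).
Proof.
rewrite /unitary_points /= map_invmx => gu.
by rewrite (invmx_unitary gu) trmxC_unitary; exact: gu.
Qed.

Lemma unitary_pointsM g h : G g -> G h -> G (g *m h).
Proof. by rewrite /unitary_points /= map_mxM; exact: mul_unitarymx. Qed.

Lemma translate_sub g : G g -> translate g `<=` G.
Proof.
move=> Gg X [/(unitary_pointsM Gg)]; rewrite mulKVmx //.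
exact: unitary_points_unit.
Qed.

Lemma translate_near g X i j : translate g X ->
  `|(map_mx phi (invmx g *m X) - 1%:M) i j| <= (tolerance R n)%:C.
Proof.
move=> [_ [_ /(_ i j)]]; rewrite -ball_normE /= -phi_lt phi_psi phi_norm => /ltW.
by rewrite -normrN -rmorphN opprB !mxE rmorphB rmorphMn rmorph1.
Qed.

Lemma haar_translate (mu : probability (borel_mx K n.+1) R) g :
  haar_probability G mu -> G g -> mu (translate g) = mu near_one.
Proof.
move=> [_ muG] Gg; exact: (muG _ (unitary_pointsV Gg) _ measurable_near_one).
Qed.

(** If X is entrywise close to g then g^-1 X - 1 = g^-1 (X - g) is small, up to
    the factor n + 1, because the entries of g^-1 have modulus at most 1. *)
Lemma finite_cover : exists2 s : seq 'M[K]_n.+1, (forall g, g \in s -> G g) &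
  forall X, G X -> exists2 g, g \in s & translate g X.
Proof.
pose e : R := tolerance R n / (2 * n.+1%:R).
have t0 := tolerance_gt0 R n.
have e0 : 0 < e by rewrite divr_gt0 // mulr_gt0 ?ltr0n.
have [//|s [sG cov]] := @unitary_net R n.+1 _ G (map_mx phi) 1%:M e unitary_points1 e0.
exists s; first exact: sG.
move=> X GX; have [g gs Xg] := cov X GX; exists g; first exact: gs.
have Gg := sG _ gs; have gu := unitary_points_unit Gg.
split; first exact/unitary_pointsM/GX/unitary_pointsV.
split; first by rewrite -phi_lt phi_psi rmorph0 ltcR.
move=> i j; rewrite -ball_normE /= -phi_lt phi_psi phi_norm.
have h := mulmx_entry_le (fun i j => unitary_entry_le1 i j (unitary_pointsV Gg)) Xg i j.
have -> : (1%:M : 'M[K]_n.+1) i j - (invmx g *m X) i j = - (invmx g *m (X - g)) i j.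
  by rewrite mulmxBr mulVmx // !mxE opprB.
rewrite rmorphN normrN.
have -> : phi ((invmx g *m (X - g)) i j) =
    (map_mx phi (invmx g) *m (map_mx phi X - map_mx phi g)) i j.
  by rewrite -map_mxB -map_mxM [RHS]mxE.
apply: le_lt_trans h _; rewrite mul1r -(rmorph_nat (real_complex R)) -rmorphM ltcR.
have N0 : n.+1%:R != 0 :> R by rewrite pnatr_eq0.
rewrite (_ : _ * e = tolerance R n / 2); last by rewrite /e; field.
lra.
Qed.

(** The total mass 1 is at most the sum of the masses of the translates in a finite
    cover, which are all equal by invariance.  The cover is chosen before mu,
    so N is independent of it. *)
Lemma haar_near_one_ge : exists2 N : nat, (0 < N)%N &
  forall mu : probability (borel_mx K n.+1) R,
    haar_probability G mu -> (N%:R^-1%:E <= mu near_one)%E.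
Proof.
have [s sG cov] := finite_cover.
have s0 : (0 < size s)%N.
  by have [g] := cov _ unitary_points1; case: s {sG cov}.
exists (size s) => // mu Hmu; have [muG _] := Hmu.
have : (mu G <= \sum_(k < size s) mu (translate (nth 1%:M s k)))%E.
  apply: (@content_subadditive _ _ _ mu G (fun k => translate (nth 1%:M s k))).
  - by move=> k _; exact: measurable_translate.
  - exact: measurable_unitary_points.
  - move=> X /cov [g gs Xg].
    rewrite -(bigcup_mkord (size s) (fun k => translate (nth 1%:M s k))).
    exists (index g s).
      by rewrite /= index_mem.
    by rewrite nth_index.
rewrite muG (eq_bigr (fun=> mu near_one)) => [|k _]; last first.
  by apply: haar_translate => //; apply: sG; rewrite mem_nth.
have /fineK <- : mu near_one \is a fin_num.
  by apply: fin_num_measure; exact: measurable_near_one.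
rewrite sumEFin !lee_fin sumr_const card_ord => h.
by rewrite -div1r ler_pdivrMr ?ltr0n // mulr_natr.
Qed.

Lemma haar_integral_ge : exists2 C : R, 0 < C &
  forall mu : probability (borel_mx K n.+1) R,
    haar_probability G mu -> forall A : 'M[R]_n.+1, \det A = 1 ->
    ((C * ln (operator_norm A))%:E <=
      \int[mu]_(X in G) (ln (spectral_radius (complexify A *m map_mx phi X)))%:E)%E.
Proof.
have [N N0 muN] := haar_near_one_ge.
exists (2^-1 * N%:R^-1); first by rewrite mulr_gt0 ?invr_gt0 ?ltr0n.
move=> mu Hmu A A1.
have f0 X : G X -> 0 <= ln (spectral_radius (complexify A *m map_mx phi X)).
  move=> GX; apply/ln_ge0/spectral_radius_ge1.
  rewrite det_mulmx /complexify det_map_mx A1 rmorph1 mul1r.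
  exact: det_unitary GX.
(* A lower bound on a measure can be multiplied only by a nonnegative number. *)
have [le0|/ltW ge0] := leP (ln (operator_norm A)) 0.
  apply: (@le_trans _ _ 0%E).
    by rewrite lee_fin pmulr_rle0 // mulr_gt0 ?invr_gt0 ?ltr0n.
  by apply: integral_ge0 => X GX; rewrite lee_fin f0.
have [g gg gain] := spectral_radius_gain A1.
pose h := map_mx psi g.
have hE : map_mx phi h = complexify g.
  by apply/matrixP => i j; rewrite !mxE phi_psi.
have Gh : G h by rewrite /unitary_points /= hE complexify_unitary gg.
apply: (@le_trans _ _ ((2^-1 * ln (operator_norm A))%:E * mu (translate h))%E).
  rewrite haar_translate // mulrAC EFinM lee_wpmul2l ?muN // lee_fin.
  by rewrite mulr_ge0 // invr_ge0.
apply: integral_ge_of_ge.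
- exact: measurable_translate.
- exact: translate_sub.
- by rewrite mulr_ge0 // invr_ge0.
- exact: f0.
move=> X Xh; have GX := translate_sub Gh Xh.
have -> : map_mx phi X = complexify g *m map_mx phi (invmx h *m X).
  by rewrite -hE -map_mxM mulKVmx // unitary_points_unit.
apply: gain; last by move=> i j; exact: translate_near.
by case: Xh.
Qed.
End IntermediateField.

(** * The orthogonal and the unitary group *)

Lemma orthogonal_groupE (R : realType) n :
  @orthogonal_group R n = unitary_points (real_complex R) (n := n).
Proof.
apply/seteqP; split => X; rewrite /unitary_points /orthogonal_group /=.
  by move=> XX; rewrite -/(complexify X) complexify_unitary XX.
by rewrite -/(complexify X) complexify_unitary => /eqP.
Qed.

Lemma unitary_groupE (R : realType) n :
  @unitary_group R n = unitary_points (@idfun R[i]) (n := n).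
Proof.
by apply/seteqP; split => X; rewrite /unitary_points /unitary_group /= map_mx_id.
Qed.

Theorem theorem4 (R : realType) (n : nat) (hn : (2 < n)%N) :
  (exists C : R, 0 < C /\
     forall mu : probability (borel_mx R n) R,
       haar_probability (@orthogonal_group R n) mu ->
       forall A : 'M[R]_n, \det A = 1 ->
         ((C * ln (operator_norm A))%:E <=
          \int[mu]_(X in @orthogonal_group R n)
             (ln (spectral_radius (complexify (A *m X))))%:E)%E) /\
  (exists C' : R, 0 < C' /\
     forall mu : probability (borel_mx R[i] n) R,
       haar_probability (@unitary_group R n) mu ->
       forall A : 'M[R]_n, \det A = 1 ->
         ((C' * ln (operator_norm A))%:E <=
          \int[mu]_(X in @unitary_group R n)
             (ln (spectral_radius (complexify A *m X)))%:E)%E).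
Proof.
case: n hn => // n _; split.
  have [||| C C0 bound] := @haar_integral_ge R R n (real_complex R) idfun.
  - by [].
  - by move=> x; rewrite normc_def /= expr0n addr0 sqrtr_sqr.
  - by move=> x y; rewrite ltcR.
  exists C; split; first exact: C0.
  rewrite orthogonal_groupE => mu Hmu A A1.
  under eq_integral do rewrite /complexify map_mxM.
  exact: bound.
have [||| C C0 bound] := @haar_integral_ge R R[i] n idfun (real_complex R).
- by [].
- by [].
- by [].
exists C; split; first exact: C0.
rewrite unitary_groupE => mu Hmu A A1.
rewrite (eq_integral (fun X : borel_mx R[i] n.+1 =>
  (ln (spectral_radius (complexify A *m map_mx idfun X)))%:E)).
  exact: bound.
by move=> X _; rewrite map_mx_id.
Qed.
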